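(* Let $\bm{V}_m\in\mathbb{C}^{n\times m}$ with $n\geq m$ have full rank, let $\bm{S}\in\mathbb{C}^{s\times n}$ be an arbitrary matrix such that $\bm{S}\bm{V}_m$ has full column rank, and let $\bm{S}\bm{V}_m=\bm{Q}_m\bm{R}_m$ be a thin QR decomposition. Let $\mathcal{V}\subset\mathbb{C}^n$ be the subspace spanned by the columns of $\bm{V}_m$. Then, for every $\bm{v}\in\mathcal{V}$, $$ \frac{1}{\sigma_{\max}^2(\bm{V}_m\bm{R}_m^{-1})}\,\|\bm{v}\|_2^2 \;\leq\; \|\bm{S}\bm{v}\|_2^2 \;\leq\; \frac{1}{\sigma_{\min}^2(\bm{V}_m\bm{R}_m^{-1})}\,\|\bm{v}\|_2^2 . $$ Moreover, the subspace distortion factor associated with $\bm{S}$ and the whitened basis $\widetilde{\bm{V}}_m=\bm{V}_m\bm{R}_m^{-1}$ of $\mathcal{V}$, namely $\kappa(\bm{S}\widetilde{\bm{V}}_m)\,\kappa(\widetilde{\bm{V}}_m)$, equals $$ \kappa(\bm{V}_m\bm{R}_m^{-1}) = \frac{\sigma_{\max}(\bm{V}_m\bm{R}_m^{-1})}{\sigma_{\min}(\bm{V}_m\bm{R}_m^{-1})}. $$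
   Context: A thin QR decomposition $\bm{S}\bm{V}_m=\bm{Q}_m\bm{R}_m$ has $\bm{Q}_m\in\mathbb{C}^{s\times m}$ with orthonormal columns and $\bm{R}_m\in\mathbb{C}^{m\times m}$ upper triangular. Basis whitening means replacing the basis $\bm{V}_m$ by the whitened basis $\widetilde{\bm{V}}_m=\bm{V}_m\bm{R}_m^{-1}$. For a matrix $\bm{M}$, $\sigma_{\max}(\bm{M})$ and $\sigma_{\min}(\bm{M})$ denote its largest and smallest singular values and $\kappa(\bm{M})=\sigma_{\max}(\bm{M})/\sigma_{\min}(\bm{M})$ its condition number. $\|\cdot\|_2$ is the Euclidean norm. For a matrix $\bm{S}$ and a basis $\bm{V}$ (full column rank matrix) of a subspace, the subspace distortion factor is $$ \sqrt{\frac{\sigma_{\max}^2(\bm{S}\bm{V})/\sigma_{\min}^2(\bm{V})}{\sigma_{\min}^2(\bm{S}\bm{V})/\sigma_{\max}^2(\bm{V})}}=\kappa(\bm{S}\bm{V})\,\kappa(\bm{V}). $$ *)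

(* Defs.v *)
(* Mathematical Components, with the complex numbers as R[i] over R : realType. *)
From mathcomp Require Import all_boot all_order all_algebra.
From mathcomp Require Import complex reals.

Set Implicit Arguments.
Unset Strict Implicit.
Unset Printing Implicit Defensive.

Import Order.TTheory GRing.Theory Num.Theory.
Local Open Scope ring_scope.
Local Open Scope sesquilinear_scope.

Definition l2norm (R : realType) (n : nat) (v : 'cV[R[i]]_n) : R :=
  Num.sqrt (\sum_i ComplexField.Normc.normc (v i 0) ^+ 2).

(* The eigenvalues with multiplicity; meaningful for normal A, see
   char_poly_eigenvalues below. *)
Definition eigenvalues (C : numClosedFieldType) (n : nat) (A : 'M[C]_n) :
    seq C :=
  [seq spectral_diag A 0 j | j <- enum 'I_n].

Lemma char_poly_eigenvalues (C : numClosedFieldType) (n : nat) (A : 'M[C]_n) :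
  A \is normalmx -> char_poly A = \prod_(l <- eigenvalues A) ('X - l%:P).
Proof.
move=> /orthomx_spectralP defA.
have Pu := spectral_unit A.
pose P := map_mx polyC (spectralmx A).
pose Pi := map_mx polyC (invmx (spectralmx A)).
have PiP : Pi *m P = 1%:M by rewrite -map_mxM mulVmx // map_mx1.
have -> : char_poly A = char_poly (diag_mx (spectral_diag A)).
  rewrite /char_poly.
  have -> : char_poly_mx A = Pi *m char_poly_mx (diag_mx (spectral_diag A)) *m P.
    rewrite /char_poly_mx mulmxBr mulmxBl scalar_mxC -(mulmxA _ Pi) PiP mulmx1.
    by rewrite -!map_mxM -defA.
  by rewrite !det_mulmx mulrAC -det_mulmx PiP det1 mul1r.
rewrite char_poly_trig ?diag_mx_is_trig // /eigenvalues big_map big_enum /=.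
by apply: eq_bigr => i _; rewrite mxE eqxx mulr1n.
Qed.

(* The min(p, q) singular values of M in decreasing order: square roots of the
   largest eigenvalues of M^* M, the remaining q - min(p, q) ones being 0. *)
Definition singular_values (R : realType) (p q : nat) (M : 'M[R[i]]_(p, q)) :
    seq R :=
  take (minn p q)
    (sort >=%R [seq Num.sqrt (complex.Re l) | l <- eigenvalues (M^t* *m M)]).

(* Both are 0 by convention when M has no row or no column. *)
Definition sigma_max (R : realType) (p q : nat) (M : 'M[R[i]]_(p, q)) : R :=
  head 0 (singular_values M).

Definition sigma_min (R : realType) (p q : nat) (M : 'M[R[i]]_(p, q)) : R :=
  last 0 (singular_values M).

Definition kappa (R : realType) (p q : nat) (M : 'M[R[i]]_(p, q)) : R :=
  sigma_max M / sigma_min M.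

Definition thin_qr (R : realType) (s m : nat)
    (A Q : 'M[R[i]]_(s, m)) (T : 'M[R[i]]_m) : Prop :=
  [/\ A = Q *m T, Q^t* *m Q = 1%:M
    & forall i j : 'I_m, (j < i)%N -> T i j = 0].

Definition cols (R : realType) (n m : nat) (V : 'M[R[i]]_(n, m)) :
    seq 'cV[R[i]]_n :=
  [seq col j V | j <- enum 'I_m].

Definition colspan (R : realType) (n m : nat) (V : 'M[R[i]]_(n, m)) :
    {vspace 'cV[R[i]]_n} :=
  <<cols V>>%VS.

Definition distortion (R : realType) (s n m : nat)
    (S : 'M[R[i]]_(s, n)) (V : 'M[R[i]]_(n, m)) : R :=
  Num.sqrt ((sigma_max (S *m V) ^+ 2 / sigma_min V ^+ 2)
            / (sigma_min (S *m V) ^+ 2 / sigma_max V ^+ 2)).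

(* invmx is the identity on singular matrices; this does not happen for the
   triangular factor of a matrix of full column rank. *)
Lemma thin_qr_unitmx (R : realType) (s m : nat)
    (A Q : 'M[R[i]]_(s, m)) (T : 'M[R[i]]_m) :
  \rank A = m -> thin_qr A Q T -> T \in unitmx.
Proof.
move=> rA [defA _ _]; rewrite -row_full_unit /row_full eqn_leq rank_leq_row /=.
by rewrite -{1}rA defA mxrankM_maxr.
Qed.

(* Main.v *)
Require Import Defs.
From mathcomp Require Import all_boot all_order all_algebra.
From mathcomp Require Import complex reals.

Import Order.TTheory GRing.Theory Num.Theory.
Local Open Scope ring_scope.
Local Open Scope sesquilinear_scope.

(** Since [S Vm = Qm Rm], the whitened basis [W = Vm Rm^-1] satisfies
    [S W = Qm], whose columns are orthonormal.  A vector of the column span of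
    [Vm] has the form [v = W x], so that [|S v| = |Qm x| = |x|], and both
    inequalities reduce to the bounds
    [sigma_min W * |x| <= |W x| <= sigma_max W * |x|] together with
    [0 < sigma_min W].  Moreover every singular value of [Qm] is 1, hence
    [kappa (S W) = 1].

    The bounds come from the spectral theorem for the Gram matrix [W^* W]
    ([l2norm_mulmx_sqr]): in the orthonormal basis of its eigenvectors [p_i],
    [|W x|^2] is the sum of the [|W p_i|^2 |y_i|^2], where the [y_i] are the
    coordinates of [x] in that basis.  As the eigenvalues are the [|W p_i|^2],
    the singular values are the norms [|W p_i|] ([mem_singular_values]); this
    gives their positivity when [W] is injective, and their value 1 when the
    columns are orthonormal. *)

Section SingularValues.
Set Implicit Arguments.
Unset Strict Implicit.
Variable R : realType.
Local Notation C := R[i].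

(** * Column spans *)

Lemma mulmx_sum_col n m (V : 'M[C]_(n, m)) (x : 'cV[C]_m) :
  V *m x = \sum_j x j 0 *: col j V.
Proof.
apply/matrixP => i k; rewrite ord1 mxE summxE.
by apply: eq_bigr => j _; rewrite !mxE mulrC.
Qed.

Lemma mem_colspan n m (V : 'M[C]_(n, m)) (v : 'cV[C]_n) :
  reflect (exists x, v = V *m x) (v \in colspan V).
Proof.
rewrite /colspan /cols span_def big_map big_enum.
apply: (iffP idP) => [/memv_sumP[u uP ->]|[x ->]].
  have /fin_all_exists[k kP] (j : 'I_m) : exists k, u j = k *: col j V.
    by apply/vlineP; apply: uP.
  exists (\col_j k j); rewrite mulmx_sum_col.
  by apply: eq_bigr => j _; rewrite mxE kP.
rewrite mulmx_sum_col; apply: memv_sumr => j _.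
by apply/vlineP; exists (x j 0).
Qed.

Lemma colspan_mulmx_unit n m (V : 'M[C]_(n, m)) (T : 'M[C]_m) :
  T \in unitmx -> colspan (V *m T) = colspan V.
Proof.
move=> Tu; apply/vspaceP => v; apply/mem_colspan/mem_colspan => -[x ->].
  by exists (T *m x); rewrite mulmxA.
by exists (invmx T *m x); rewrite mulmxA mulmxK.
Qed.

(** Injectivity of a matrix with linearly independent columns. *)
Lemma mulmx_col_free n m (V : 'M[C]_(n, m)) (x : 'cV[C]_m) :
  \rank V = m -> V *m x = 0 -> x = 0.
Proof.
move=> rV Vx0; have /row_freeP[B VB] : row_free V^T.
  by rewrite /row_free mxrank_tr rV.
by rewrite -[LHS]mul1mx -[1%:M]trmx1 -VB trmx_mul trmxK -mulmxA Vx0 mulmx0.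
Qed.

Lemma free_cols n m (V : 'M[C]_(n, m)) : \rank V = m -> free (cols V).
Proof.
move=> rV; apply/(freeP (X := mktuple (fun j => col j V))) => k sum0 j.
have : V *m (\col_j k j) = 0.
  rewrite mulmx_sum_col -[RHS]sum0; apply: eq_bigr => l _.
  by rewrite mxE -tnth_nth tnth_mktuple.
by move/(mulmx_col_free rV)/matrixP/(_ j 0); rewrite !mxE.
Qed.

(** * Euclidean norm *)

Lemma l2norm_ge0 n (v : 'cV[C]_n) : 0 <= l2norm v.
Proof. exact: sqrtr_ge0. Qed.

Lemma sqr_l2norm n (v : 'cV[C]_n) :
  l2norm v ^+ 2 = \sum_i ComplexField.Normc.normc (v i 0) ^+ 2.
Proof. by rewrite sqr_sqrtr // sumr_ge0 // => i _; rewrite sqr_ge0. Qed.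

Lemma real_complex_normc (z : C) :
  real_complex R (ComplexField.Normc.normc z ^+ 2) = z^* * z.
Proof. by rewrite rmorphXn /= [LHS](normCKC z). Qed.

Lemma real_complex_sqr_l2norm n (v : 'cV[C]_n) :
  real_complex R (l2norm v ^+ 2) = (v^t* *m v) 0 0.
Proof.
rewrite sqr_l2norm rmorph_sum mxE; apply: eq_bigr => i _ /=.
by rewrite real_complex_normc !mxE.
Qed.

Lemma l2norm_eq0 n (v : 'cV[C]_n) : (l2norm v == 0) = (v == 0).
Proof.
apply/eqP/eqP => [v0|->]; last first.
  rewrite /l2norm big1 ?sqrtr0 // => i _.
  by rewrite mxE ComplexField.Normc.normc0 expr0n.
apply/matrixP => i j; rewrite ord1 mxE; apply: ComplexField.Normc.eq0_normc.
have /esym/eqP := sqr_l2norm v; rewrite v0 expr0n /= psumr_eq0; last first.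
  by move=> k _; rewrite sqr_ge0.
by move=> /allP/(_ i (mem_index_enum _)); rewrite /= sqrf_eq0 => /eqP.
Qed.

Lemma l2norm_isometry p q (Q : 'M[C]_(p, q)) (x : 'cV[C]_q) :
  Q^t* *m Q = 1%:M -> l2norm (Q *m x) = l2norm x.
Proof.
move=> QQ; apply/eqP; rewrite -(@eqrXn2 _ 2) ?l2norm_ge0 //; apply/eqP.
apply: complexI; rewrite !real_complex_sqr_l2norm trmx_mul map_mxM.
by rewrite mulmxA -(mulmxA _ _ Q) QQ mulmx1.
Qed.

Lemma l2norm_delta n (i : 'I_n) : l2norm (delta_mx i 0 : 'cV[C]_n) = 1.
Proof.
rewrite /l2norm (bigD1 i) //= big1 ?addr0 => [|j ji].
  by rewrite mxE !eqxx ComplexField.Normc.normc1 expr1n sqrtr1.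
by rewrite mxE (negPf ji) ComplexField.Normc.normc0 expr0n.
Qed.

(** * Spectral decomposition of the Gram matrix *)

Section Gram.
Variables (p q : nat) (M : 'M[C]_(p, q)).
Local Notation G := (M^t* *m M).

Lemma gram_normalmx : G \is normalmx.
Proof. by apply/normalmxP; rewrite trmx_mul map_mxM /= trmxCK. Qed.

(** The right singular vectors of [M]: an orthonormal basis of eigenvectors of
    [M^* M]. *)
Definition right_singular (i : 'I_q) : 'cV[C]_q :=
  (spectralmx G)^t* *m delta_mx i 0.

Lemma l2norm_right_singular i : l2norm (right_singular i) = 1.
Proof.
rewrite l2norm_isometry ?l2norm_delta // trmxCK.
exact/unitarymxP/spectral_unitarymx.
Qed.

Lemma real_complex_sqr_l2norm_mulmx (x : 'cV[C]_q) :
  real_complex R (l2norm (M *m x) ^+ 2) =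
  \sum_i spectral_diag G 0 i
    * real_complex R (ComplexField.Normc.normc ((spectralmx G *m x) i 0) ^+ 2).
Proof.
rewrite real_complex_sqr_l2norm trmx_mul map_mxM mulmxA -(mulmxA _ _ M).
have /orthomx_spectralP {1}-> := gram_normalmx.
rewrite (invmx_unitary (spectral_unitarymx _)).
set P := spectralmx _; set d := spectral_diag _.
have -> : x ^t* *m (P ^t* *m diag_mx d *m P) *m x
   = (P *m x)^t* *m (diag_mx d *m (P *m x)).
  by rewrite trmx_mul map_mxM !mulmxA.
move: (P *m x) => y; rewrite mul_diag_mx mxE; apply: eq_bigr => i _.
by rewrite real_complex_normc !mxE mulrCA.
Qed.

Lemma spectral_diag_gram i :
  spectral_diag G 0 i = real_complex R (l2norm (M *m right_singular i) ^+ 2).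
Proof.
rewrite real_complex_sqr_l2norm_mulmx /right_singular mulmxA.
have /unitarymxP -> := spectral_unitarymx G.
rewrite mul1mx (bigD1 i) //= big1 ?addr0 => [|j ji].
  by rewrite mxE !eqxx ComplexField.Normc.normc1 expr1n rmorph1 mulr1.
by rewrite mxE (negPf ji) ComplexField.Normc.normc0 expr0n rmorph0 mulr0.
Qed.

Lemma l2norm_mulmx_sqr (x : 'cV[C]_q) :
  l2norm (M *m x) ^+ 2 =
  \sum_i l2norm (M *m right_singular i) ^+ 2
    * ComplexField.Normc.normc ((spectralmx G *m x) i 0) ^+ 2.
Proof.
apply: complexI; rewrite real_complex_sqr_l2norm_mulmx rmorph_sum.
by apply: eq_bigr => i _; rewrite spectral_diag_gram [RHS]rmorphM.
Qed.

(** * Singular values *)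

Hypothesis qp : (q <= p)%N.

(** As [q <= p], the truncation in [singular_values] discards nothing. *)
Lemma mem_singular_values :
  singular_values M =i
  [seq l2norm (M *m right_singular i) | i <- enum 'I_q].
Proof.
move=> t; rewrite /singular_values take_oversize; last first.
  by rewrite size_sort size_map size_map size_enum_ord leq_min qp leqnn.
rewrite mem_sort -map_comp; congr (t \in _).
apply: eq_map => i /=; rewrite spectral_diag_gram /=.
by rewrite sqrtr_sqr ger0_norm // l2norm_ge0.
Qed.

Lemma singular_values_sorted : sorted >=%R (singular_values M).
Proof. exact/take_sorted/sort_sorted/ge_total. Qed.

Lemma singular_values_le_max t : t \in singular_values M -> t <= sigma_max M.
Proof.
rewrite /sigma_max; have := singular_values_sorted.
rewrite (sorted_pairwise ge_trans); case: (singular_values M) => //= h s.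
by case/andP=> /allP hs _; rewrite inE => /predU1P[->//|/hs].
Qed.

Lemma singular_values_ge_min t : t \in singular_values M -> sigma_min M <= t.
Proof.
rewrite /sigma_min; have := singular_values_sorted.
rewrite (sorted_pairwise ge_trans); case/lastP: (singular_values M) => // s l.
rewrite pairwise_rcons last_rcons mem_rcons inE => /andP[/allP sl _].
by case/predU1P=> [->//|/sl].
Qed.

Lemma size_singular_values : size (singular_values M) = q.
Proof.
by rewrite size_takel (minn_idPr qp) // size_sort size_map
    size_map size_enum_ord.
Qed.

Lemma sigma_max_mem : (0 < q)%N -> sigma_max M \in singular_values M.
Proof.
rewrite /sigma_max -{1}size_singular_values.
by case: (singular_values M) => //= h s _; exact: mem_head.
Qed.

Lemma sigma_min_mem : (0 < q)%N -> sigma_min M \in singular_values M.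
Proof.
rewrite /sigma_min -{1}size_singular_values.
by case: (singular_values M) => //= h s _; exact: mem_last.
Qed.

Lemma sigma_max_ge0 : 0 <= sigma_max M.
Proof.
have [q0|] := posnP q; last first.
  move=> /sigma_max_mem; rewrite mem_singular_values => /mapP[i _ ->].
  exact: l2norm_ge0.
by rewrite /sigma_max; move/size0nil: (etrans size_singular_values q0) => ->.
Qed.

Lemma sigma_min_ge0 : 0 <= sigma_min M.
Proof.
have [q0|] := posnP q; last first.
  move=> /sigma_min_mem; rewrite mem_singular_values => /mapP[i _ ->].
  exact: l2norm_ge0.
by rewrite /sigma_min; move/size0nil: (etrans size_singular_values q0) => ->.
Qed.

Lemma sum_sqr_spectral_coord (x : 'cV[C]_q) :
  \sum_i ComplexField.Normc.normc ((spectralmx G *m x) i 0) ^+ 2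
  = l2norm x ^+ 2.
Proof.
rewrite -sqr_l2norm l2norm_isometry //.
exact/mulmx1C/unitarymxP/spectral_unitarymx.
Qed.

Lemma l2norm_mulmx_le (x : 'cV[C]_q) :
  l2norm (M *m x) ^+ 2 <= sigma_max M ^+ 2 * l2norm x ^+ 2.
Proof.
rewrite l2norm_mulmx_sqr -sum_sqr_spectral_coord mulr_sumr.
apply: ler_sum => i _; rewrite ler_wpM2r ?sqr_ge0 //.
rewrite lerXn2r ?nnegrE ?sigma_max_ge0 ?l2norm_ge0 //.
apply: singular_values_le_max.
by rewrite mem_singular_values; apply/map_f/mem_enum.
Qed.

Lemma l2norm_mulmx_ge (x : 'cV[C]_q) :
  sigma_min M ^+ 2 * l2norm x ^+ 2 <= l2norm (M *m x) ^+ 2.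
Proof.
rewrite l2norm_mulmx_sqr -sum_sqr_spectral_coord mulr_sumr.
apply: ler_sum => i _; rewrite ler_wpM2r ?sqr_ge0 //.
rewrite lerXn2r ?nnegrE ?sigma_min_ge0 ?l2norm_ge0 //.
apply: singular_values_ge_min.
by rewrite mem_singular_values; apply/map_f/mem_enum.
Qed.

Lemma sigma_min_gt0 : (0 < q)%N -> \rank M = q -> 0 < sigma_min M.
Proof.
move=> q0 rM; rewrite lt_def sigma_min_ge0 andbT.
have := sigma_min_mem q0; rewrite mem_singular_values => /mapP[i _ ->].
rewrite l2norm_eq0; apply/eqP => Mi0.
have /eqP : right_singular i = 0 by apply: mulmx_col_free rM Mi0.
by rewrite -l2norm_eq0 l2norm_right_singular oner_eq0.
Qed.

Lemma singular_values_isometry t :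
  G = 1%:M -> t \in singular_values M -> t = 1.
Proof.
move=> G1; rewrite mem_singular_values => /mapP[i _ ->].
by rewrite l2norm_isometry // l2norm_right_singular.
Qed.

(** The hypothesis [0 < q] excludes matrices without columns, whose [kappa] is
    [0 / 0 = 0]. *)
Lemma kappa_isometry : (0 < q)%N -> G = 1%:M -> kappa M = 1.
Proof.
move=> q0 G1; rewrite /kappa.
rewrite (singular_values_isometry G1 (sigma_max_mem q0)).
by rewrite (singular_values_isometry G1 (sigma_min_mem q0)) divr1.
Qed.

Lemma kappa_nocol : q = 0%N -> kappa M = 0.
Proof.
move=> q0; rewrite /kappa /sigma_max.
by move/size0nil: (etrans size_singular_values q0) => ->; rewrite mul0r.
Qed.

End Gram.

Lemma distortion_kappa s n m (S : 'M[C]_(s, n)) (V : 'M[C]_(n, m)) :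
  (m <= s)%N -> (m <= n)%N ->
  distortion S V = kappa (S *m V) * kappa V.
Proof.
move=> ms mn; rewrite /distortion /kappa.
rewrite -!expr_div_n sqrtr_sqr ger0_norm; last first.
  by rewrite !divr_ge0 ?sigma_max_ge0 ?sigma_min_ge0.
by rewrite invf_div mulrACA [X in _ * X = _]mulrC mulrACA.
Qed.

End SingularValues.

(** * The whitened basis *)

Theorem corollary3p2 (R : realType) (n m s : nat)
    (Vm : 'M[R[i]]_(n, m)) (S : 'M[R[i]]_(s, n))
    (Qm : 'M[R[i]]_(s, m)) (Rm : 'M[R[i]]_m) :
  (m <= n)%N ->
  \rank Vm = m ->
  \rank (S *m Vm) = m ->
  thin_qr (S *m Vm) Qm Rm ->
  let W := Vm *m invmx Rm in
  [/\ forall v : 'cV[R[i]]_n, v \in colspan Vm ->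
        1 / sigma_max W ^+ 2 * l2norm v ^+ 2 <= l2norm (S *m v) ^+ 2
        /\ l2norm (S *m v) ^+ 2 <= 1 / sigma_min W ^+ 2 * l2norm v ^+ 2,
      basis_of (colspan Vm) (cols W),
      distortion S W = kappa (S *m W) * kappa W
    & kappa (S *m W) * kappa W = kappa W].
Proof.
move=> mn rV rSV qr W.
have Ru := thin_qr_unitmx rSV qr; have [SVQR QQ _] := qr.
have RiU : invmx Rm \in unitmx by rewrite unitmx_inv.
have ms : (m <= s)%N by rewrite -rSV rank_leq_row.
have SW : S *m W = Qm by rewrite /W mulmxA SVQR mulmxK.
have rW : \rank W = m by rewrite mxrankMfree // row_free_unit.
have spanW : colspan W = colspan Vm by apply: colspan_mulmx_unit.
split.
- move=> v; rewrite -spanW => /mem_colspan[x ->].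
  rewrite mulmxA SW (l2norm_isometry x QQ); split.
    (* If [sigma_max W] is 0, which means [m = 0], its inverse is 0 too. *)
    have [->|max0] := eqVneq (sigma_max W) 0.
      by rewrite expr0n invr0 mulr0 mul0r sqr_ge0.
    rewrite div1r mulrC ler_pdivrMr ?exprn_even_gt0 //.
    by rewrite mulrC l2norm_mulmx_le.
  (* Without columns [sigma_min W] is 0, but then [x] is 0 as well. *)
  have [m0|m0] := posnP m.
    have -> : x = 0 by apply/matrixP => j; have := ltn_ord j; rewrite {2}m0.
    have /eqP -> : l2norm (0 : 'cV[R[i]]_m) == 0 by rewrite l2norm_eq0.
    by rewrite expr0n mulr_ge0 ?sqr_ge0 // div1r invr_ge0 sqr_ge0.
  rewrite div1r mulrC ler_pdivlMr ?exprn_gt0 ?sigma_min_gt0 //.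
  by rewrite mulrC l2norm_mulmx_ge.
- by rewrite /basis_of -spanW eqxx free_cols.
- exact: distortion_kappa.
- have [m0|m0] := posnP m; first by rewrite (kappa_nocol W mn m0) mulr0.
  by rewrite SW (kappa_isometry ms m0 QQ) mul1r.
Qed.
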